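(* There exists a linear group $G$ such that $G \otimes G = G \wedge G$ (that is, the canonical epimorphism $G\otimes G \to G\wedge G$ is an isomorphism) and this group is not linear.
   Context: A group is called linear if, for some positive integer $n$ and some field $P$, it is isomorphic to a subgroup of $GL_n(P)$. For elements of a group $G$ write $x^y = y^{-1}xy$. The non-abelian tensor square $G\otimes G$ is the group generated by the symbols $g\otimes h$ ($g,h\in G$) subject to the relations $gg_1\otimes h = (g^{g_1}\otimes h^{g_1})(g_1\otimes h)$ and $g\otimes hh_1 = (g\otimes h_1)(g^{h_1}\otimes h^{h_1})$ for all $g,g_1,h,h_1\in G$. The exterior square $G\wedge G$ is the quotient of $G\otimes G$ by the normal subgroup generated by all elements $g\otimes g$, $g\in G$. *)

(* Defs.v *)
From HB Require Import structures.
From mathcomp Require Import all_boot all_algebra.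
From mathcomp Require Import boolp classical_sets functions.

Set Implicit Arguments.
Unset Strict Implicit.
Unset Printing Implicit Defensive.

Local Open Scope quotient_scope.
Local Open Scope group_scope.

(* A word is a sequence of letters (x, b), standing for x if b = false and for
   x^-1 if b = true. *)
Section Presentation.
Variables (X : choiceType) (R : seq (X * bool) -> seq (X * bool) -> Prop).
Implicit Types u v w : seq (X * bool).

Inductive pres_eq : seq (X * bool) -> seq (X * bool) -> Prop :=
| PresRel u v : R u v -> pres_eq u v
| PresCancel x b : pres_eq [:: (x, b); (x, ~~ b)] [::]
| PresCat u u' v v' :
    pres_eq u u' -> pres_eq v v' -> pres_eq (u ++ v) (u' ++ v')
| PresRefl u : pres_eq u u
| PresSym u v : pres_eq u v -> pres_eq v u
| PresTrans u v w : pres_eq u v -> pres_eq v w -> pres_eq u w.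

Let pres_eqb u v := `[< pres_eq u v >].

Lemma pres_eqb_refl : reflexive pres_eqb.
Proof. by move=> u; apply/asboolP/PresRefl. Qed.

Lemma pres_eqb_sym : symmetric pres_eqb.
Proof. by move=> u v; apply/asboolP/asboolP => /PresSym. Qed.

Lemma pres_eqb_trans : transitive pres_eqb.
Proof.
by move=> v u w /asboolP uv /asboolP vw; apply/asboolP; apply: PresTrans vw.
Qed.

Definition pres_equiv := EquivRel pres_eqb pres_eqb_refl pres_eqb_sym
  pres_eqb_trans.

(* The group with generators X and relations u = v for R u v. *)
Definition presented := {eq_quot pres_equiv}.

HB.instance Definition _ := Choice.on presented.
HB.instance Definition _ := EqQuotient.on presented.

Definition word_inv u := rev [seq (a.1, ~~ a.2) | a <- u].

Definition presented_mul (a b : presented) : presented :=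
  \pi_presented (repr a ++ repr b).
Definition presented_one : presented := \pi_presented [::].
Definition presented_inv (a : presented) : presented :=
  \pi_presented (word_inv (repr a)).

Lemma presentedP u v :
  \pi_presented u = \pi_presented v <-> pres_eq u v.
Proof.
split; first by move=> /eqmodP /asboolP.
by move=> uv; apply/eqmodP/asboolP.
Qed.

Lemma repr_presented u : pres_eq (repr (\pi_presented u)) u.
Proof. by apply/presentedP; rewrite reprK. Qed.

Lemma presented_mulE u v :
  presented_mul (\pi_presented u) (\pi_presented v) = \pi_presented (u ++ v).
Proof. by apply/presentedP; apply: PresCat; apply: repr_presented. Qed.

Lemma word_inv_cat u v : word_inv (u ++ v) = word_inv v ++ word_inv u.
Proof. by rewrite /word_inv map_cat rev_cat. Qed.

Lemma word_invK : involutive word_inv.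
Proof.
move=> u; rewrite /word_inv map_rev revK -map_comp -[RHS]map_id.
by apply: eq_map => -[x b] /=; rewrite negbK.
Qed.

Lemma word_mulV u : pres_eq (u ++ word_inv u) [::].
Proof.
elim: u => [|[x b] u IHu]; first exact: PresRefl.
rewrite -cat1s word_inv_cat catA -(catA _ u).
apply: (@PresTrans _ ([:: (x, b)] ++ [::] ++ word_inv [:: (x, b)])).
  rewrite -!catA; apply: PresCat; first exact: PresRefl.
  by rewrite catA; apply: PresCat => //; apply: PresRefl.
exact: PresCancel.
Qed.

Lemma word_mulVl u : pres_eq (word_inv u ++ u) [::].
Proof. by have := word_mulV (word_inv u); rewrite word_invK. Qed.

Lemma presented_reprK (a : presented) : \pi_presented (repr a) = a.
Proof. exact: reprK. Qed.

Lemma presented_mulA : associative presented_mul.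
Proof.
move=> a b c.
rewrite -[a]presented_reprK -[b]presented_reprK -[c]presented_reprK.
by rewrite !presented_mulE catA.
Qed.

Lemma presented_mul1 : left_id presented_one presented_mul.
Proof. by move=> a; rewrite -[a]presented_reprK presented_mulE. Qed.

Lemma presented_mulr1 : right_id presented_one presented_mul.
Proof. by move=> a; rewrite -[a]presented_reprK presented_mulE cats0. Qed.

Lemma presented_mulV : left_inverse presented_one presented_inv presented_mul.
Proof.
move=> a; rewrite -{2}[a]presented_reprK presented_mulE.
exact/presentedP/word_mulVl.
Qed.

Lemma presented_mulVr :
  right_inverse presented_one presented_inv presented_mul.
Proof.
move=> a; rewrite -{1}[a]presented_reprK presented_mulE.
exact/presentedP/word_mulV.
Qed.

HB.instance Definition _ := isGroup.Build presented
  presented_mulA presented_mul1 presented_mulr1 presented_mulV presented_mulVr.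

Definition presented_gen (x : X) : presented := \pi_presented [:: (x, false)].

End Presentation.

Section NormalQuotient.
Variables (G : groupType) (S : set G).
Implicit Types x y z : G.

Inductive normal_closure : G -> Prop :=
| NormalGen x : S x -> normal_closure x
| Normal1 : normal_closure 1
| NormalM x y : normal_closure x -> normal_closure y -> normal_closure (x * y)
| NormalV x : normal_closure x -> normal_closure x^-1
| NormalJ x y : normal_closure x -> normal_closure (x ^ y).

Let cosetb x y := `[< normal_closure (x^-1 * y) >].

Lemma cosetb_refl : reflexive cosetb.
Proof. by move=> x; apply/asboolP; rewrite mulVg; apply: Normal1. Qed.

Lemma cosetb_sym : symmetric cosetb.
Proof.
by move=> x y; apply/asboolP/asboolP => /NormalV; rewrite invgM invgK.
Qed.

Lemma cosetb_trans : transitive cosetb.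
Proof.
move=> y x z /asboolP xy /asboolP yz; apply/asboolP.
by have := NormalM xy yz; rewrite -mulgA mulVKg.
Qed.

Definition coset_equiv := EquivRel cosetb cosetb_refl cosetb_sym cosetb_trans.

(* The quotient of G by the normal closure of S. *)
Definition nquotient := {eq_quot coset_equiv}.

HB.instance Definition _ := Choice.on nquotient.
HB.instance Definition _ := EqQuotient.on nquotient.

Definition nquotient_proj (x : G) : nquotient := \pi_nquotient x.

Definition nquotient_mul (a b : nquotient) : nquotient :=
  nquotient_proj (repr a * repr b).
Definition nquotient_inv (a : nquotient) : nquotient :=
  nquotient_proj (repr a)^-1.

Lemma nquotientP x y :
  nquotient_proj x = nquotient_proj y <-> normal_closure (x^-1 * y).
Proof.
split; first by move=> /eqmodP /asboolP.
by move=> xy; apply/eqmodP/asboolP.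
Qed.

Lemma nquotient_reprK a : nquotient_proj (repr a) = a.
Proof. exact: reprK. Qed.

Lemma nquotient_mulE x y :
  nquotient_mul (nquotient_proj x) (nquotient_proj y) = nquotient_proj (x * y).
Proof.
set a := nquotient_proj x; set b := nquotient_proj y.
have /nquotientP xP : nquotient_proj (repr a) = nquotient_proj x.
  exact: reprK.
have /nquotientP yP : nquotient_proj (repr b) = nquotient_proj y.
  exact: reprK.
apply/nquotientP; have := NormalM (NormalJ (repr b) xP) yP.
by rewrite /conjg invgM !mulgA mulgK.
Qed.

Lemma nquotient_mulA : associative nquotient_mul.
Proof.
move=> a b c.
rewrite -[a]nquotient_reprK -[b]nquotient_reprK -[c]nquotient_reprK.
by rewrite !nquotient_mulE mulgA.
Qed.

Lemma nquotient_mul1 : left_id (nquotient_proj 1) nquotient_mul.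
Proof. by move=> a; rewrite -[a]nquotient_reprK nquotient_mulE mul1g. Qed.

Lemma nquotient_mulr1 : right_id (nquotient_proj 1) nquotient_mul.
Proof. by move=> a; rewrite -[a]nquotient_reprK nquotient_mulE mulg1. Qed.

Lemma nquotient_mulV :
  left_inverse (nquotient_proj 1) nquotient_inv nquotient_mul.
Proof. by move=> a; rewrite -{2}[a]nquotient_reprK nquotient_mulE mulVg. Qed.

Lemma nquotient_mulVr :
  right_inverse (nquotient_proj 1) nquotient_inv nquotient_mul.
Proof. by move=> a; rewrite -{1}[a]nquotient_reprK nquotient_mulE mulgV. Qed.

HB.instance Definition _ := isGroup.Build nquotient
  nquotient_mulA nquotient_mul1 nquotient_mulr1 nquotient_mulV nquotient_mulVr.

Lemma nquotient_projM : {morph nquotient_proj : x y / x * y}.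
Proof. by move=> x y; rewrite -nquotient_mulE. Qed.

HB.instance Definition _ :=
  isMultiplicative.Build G nquotient nquotient_proj nquotient_projM.

End NormalQuotient.

Section TensorSquare.
Variable G : groupType.
Implicit Types g h : G.

Local Notation t g h := ((g, h), false).

Inductive tensor_rel : seq ((G * G) * bool) -> seq ((G * G) * bool) -> Prop :=
| TensorMl g g1 h :
    tensor_rel [:: t (g * g1) h] [:: t (g ^ g1) (h ^ g1); t g1 h]
| TensorMr g h h1 :
    tensor_rel [:: t g (h * h1)] [:: t g h1; t (g ^ h1) (h ^ h1)].

Definition tensor_square : groupType := presented tensor_rel.

Definition tensor g h : tensor_square := presented_gen tensor_rel (g, h).

Lemma tensorMl g g1 h :
  tensor (g * g1) h = tensor (g ^ g1) (h ^ g1) * tensor g1 h.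
Proof.
by rewrite [RHS]presented_mulE; apply/presentedP/PresRel/TensorMl.
Qed.

Lemma tensorMr g h h1 :
  tensor g (h * h1) = tensor g h1 * tensor (g ^ h1) (h ^ h1).
Proof.
by rewrite [RHS]presented_mulE; apply/presentedP/PresRel/TensorMr.
Qed.

Definition exterior_square : groupType :=
  nquotient [set tensor g g | g in [set: G]]%classic.

Definition exterior_proj :
    {multiplicative tensor_square -> exterior_square} :=
  @nquotient_proj tensor_square [set tensor g g | g in [set: G]]%classic.

End TensorSquare.

Section GeneralLinear.
Variables (n : nat) (P : fieldType).

(* The library's {'GL_n[P]} requires P to be finite. *)
Definition GL := {A : 'M[P]_n | A \in unitmx}.

HB.instance Definition _ := Choice.on GL.

Definition GL_mul (A B : GL) : GL :=
  exist _ (val A *m val B)%R (etrans (unitmx_mul _ _) (introT andP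
    (conj (valP A) (valP B)))).
Definition GL_one : GL := exist _ 1%:M%R (unitmx1 P n).
Definition GL_inv (A : GL) : GL :=
  exist _ (invmx (val A)) (etrans (unitmx_inv _) (valP A)).

Lemma GL_mulA : associative GL_mul.
Proof. by move=> A B C; apply: val_inj; apply: mulmxA. Qed.

Lemma GL_mul1 : left_id GL_one GL_mul.
Proof. by move=> A; apply: val_inj; apply: mul1mx. Qed.

Lemma GL_mulr1 : right_id GL_one GL_mul.
Proof. by move=> A; apply: val_inj; apply: mulmx1. Qed.

Lemma GL_mulV : left_inverse GL_one GL_inv GL_mul.
Proof. by move=> A; apply: val_inj; apply: mulVmx (valP A). Qed.

Lemma GL_mulVr : right_inverse GL_one GL_inv GL_mul.
Proof. by move=> A; apply: val_inj; apply: mulmxV (valP A). Qed.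

HB.instance Definition _ := isGroup.Build GL
  GL_mulA GL_mul1 GL_mulr1 GL_mulV GL_mulVr.

End GeneralLinear.

Definition linear_group (G : groupType) : Prop :=
  exists (n : nat) (P : fieldType) (H : set (GL n P)),
    [/\ (0 < n)%N, group_closed (mem H) &
      exists f : {multiplicative G -> GL n P}, set_bij [set: G]%classic H f].

(* Main.v *)
From HB Require Import structures.
Require Import Defs.
From mathcomp Require Import all_boot all_algebra all_field.
From mathcomp Require Import boolp classical_sets functions.

(** The idea is to find a perfect linear group G whose Schur multiplier makes
    infinitely many commuting pairs of elements of G stop commuting in a
    controlled way when they are lifted to the tensor square.

    For any group G, sending g (x) h to [g, h] defines a homomorphism from the
    tensor square to G, and in the tensor square [x, y] is the tensor of the
    images of x and y (comm_tensor). If G is perfect, then every g is the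
    image of some x, so g (x) g = [x, x] = 1: the tensor square is the
    exterior square. It is also a central extension of G in which u (x) v is
    the commutator of lifts of u and v. It is not linear as soon as it
    contains elements a_0, a_1, ... and b_0, b_1, ... such that a_i commutes
    with b_j for j <= i but not with b_(i+1): in a matrix group the a_i would
    be linearly independent (staircase_not_linear).

    Let P be a subring of a field F and Q a P-submodule of F. Let the group
    generated by the pairs of elementary matrices over P of size 3 that are
    congruent modulo Q act on columns v over P through the first matrix and on
    rows w over P through the second one. The group G is the corresponding
    semidirect product; it embeds in GL_4(F) x GL_4(F), hence in GL_8(F), and
    it is perfect by the Steinberg relations. Columns and rows commute in G,
    so v (x) w is biadditive and invariant. For a single coordinate,
    invariance forces a (x) b to depend only on a b and to vanish when a b is
    in Q (delta_tensor_eq1). Conversely, the product w v modulo Q defines a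
    central extension of G by F / Q: its cocycle identity holds
    because the two actions agree modulo Q. There columns and rows lift
    to elements with commutator w v, so a (x) b is not trivial when a b is not
    in Q (delta_tensor_neq1).

    It remains to find c_i and d_j in P with c_i d_j in Q for j <= i and c_i
    d_(i+1) not in Q. Take for P the ring of algebraic integers, Q = 2 P, d_j
    = r_j and c_i = 2 / r_i with r_j = 2^(1/2^j): then c_i d_j / 2 = r_j / r_i
    is a power of r_i if j <= i, and the inverse of r_(i+1), which is not
    integral, if j = i + 1. *)

Set Implicit Arguments.
Unset Strict Implicit.
Unset Printing Implicit Defensive.

Import GRing.Theory Num.Theory.

Local Open Scope quotient_scope.
Local Open Scope group_scope.

(** * Homomorphisms out of a presented group and of a tensor square *)

Section PresentedLift.
Variables (X : choiceType) (R : seq (X * bool) -> seq (X * bool) -> Prop).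
Variables (K : groupType) (f : X -> K).

Definition letter_val (a : X * bool) : K := if a.2 then (f a.1)^-1 else f a.1.
Definition word_val u : K := \prod_(a <- u) letter_val a.

Hypothesis fR : forall u v, R u v -> word_val u = word_val v.

Lemma word_val_pres_eq u v : pres_eq R u v -> word_val u = word_val v.
Proof.
elim=> {u v} [u v /fR //|x b|u u' v v' _ IHu _ IHv|//|//|u v w _ -> _ -> //].
  rewrite /word_val !big_cons !big_nil mulg1 /letter_val /=.
  by case: b; rewrite /= (mulVg, mulgV).
by rewrite /word_val !big_cat; congr (_ * _).
Qed.

(** The relations are an argument so that the morphism structure below, which
    depends on them, can be attached to the function. *)
Definition presented_lift of (forall u v, R u v -> word_val u = word_val v) :=
  fun a : presented R => word_val (repr a).

Lemma presented_liftE u : presented_lift fR (\pi u) = word_val u.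
Proof. exact/word_val_pres_eq/repr_presented. Qed.

Lemma presented_liftM : {morph presented_lift fR : a b / a * b}.
Proof.
move=> a b; rewrite -[a]presented_reprK -[b]presented_reprK.
rewrite [X in presented_lift _ X]presented_mulE !presented_liftE.
exact: big_cat.
Qed.

Lemma presented_lift_gen x : presented_lift fR (presented_gen R x) = f x.
Proof. by rewrite presented_liftE /word_val big_seq1. Qed.

End PresentedLift.

HB.instance Definition _ (X : choiceType) R (K : groupType) (f : X -> K) fR :=
  isMultiplicative.Build (presented R) K (presented_lift fR)
    (@presented_liftM X R K f fR).

Lemma morph_group1 (G H : groupType) (f : {multiplicative G -> H}) : f 1 = 1.
Proof. by apply: (mulgI (f 1)); rewrite -gmulfM !mulg1. Qed.

Lemma morph_groupV (G H : groupType) (f : {multiplicative G -> H}) x :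
  f x^-1 = (f x)^-1.
Proof. by apply: (mulgI (f x)); rewrite -gmulfM !mulgV morph_group1. Qed.

Lemma morph_groupJ (G H : groupType) (f : {multiplicative G -> H}) x y :
  f (x ^ y) = f x ^ f y.
Proof. by rewrite /conjg !gmulfM morph_groupV. Qed.

Lemma morph_groupR (G H : groupType) (f : {multiplicative G -> H}) x y :
  f [~ x, y] = [~ f x, f y].
Proof. by rewrite !commgEl gmulfM morph_groupJ morph_groupV. Qed.

Lemma presented_ind (X : choiceType) R (S : presented R -> Prop) :
    (forall x : X, S (presented_gen R x)) ->
    (forall a b, S a -> S b -> S (a * b)) -> (forall a, S a -> S a^-1) ->
  S 1 -> forall a, S a.
Proof.
move=> Sg SM SV S1 a; rewrite -[a]presented_reprK.
elim: (repr a) => [//|[x b] u IHu].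
rewrite -cat1s -(presented_mulE R [:: (x, b)] u); apply: SM => //.
case: b; last exact: Sg.
have <- : (presented_gen R x)^-1 = \pi_(presented R) [:: (x, true)].
  apply: mulg1_eq; rewrite [LHS]presented_mulE.
  exact/presentedP/PresCancel.
exact: SV.
Qed.

Section TensorLift.
Variables (G K : groupType) (f : G -> G -> K).
Hypothesis fMl : forall g g1 h, f (g * g1) h = f (g ^ g1) (h ^ g1) * f g1 h.
Hypothesis fMr : forall g h h1, f g (h * h1) = f g h1 * f (g ^ h1) (h ^ h1).

Lemma tensor_lift :
  exists F : {multiplicative tensor_square G -> K},
    forall g h, F (tensor g h) = f g h.
Proof.
pose ff (x : G * G) := f x.1 x.2.
have fR u v : tensor_rel u v -> word_val ff u = word_val ff v.
  by case=> [g g1 h|g h h1];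
    rewrite /word_val !big_cons !big_nil !mulg1 /letter_val /ff /= (fMl, fMr).
exists (presented_lift fR) => g h; exact: (presented_lift_gen fR (g, h)).
Qed.

End TensorLift.

(** * Commutators in a tensor square *)

Lemma commMgJ (G : groupType) (g g1 h : G) :
  [~ g * g1, h] = [~ g ^ g1, h ^ g1] * [~ g1, h].
Proof. by rewrite -conjRg /commg /conjg !invgM !mulgA !mulgK. Qed.

Lemma commgMJ (G : groupType) (g h h1 : G) :
  [~ g, h * h1] = [~ g, h1] * [~ g ^ h1, h ^ h1].
Proof. by rewrite -conjRg /commg /conjg !invgM !mulgA !mulgK. Qed.

Section CommutatorMap.
Variable G : groupType.
Implicit Types (g h k : G) (x y z : tensor_square G).

Definition tensor_comm : {multiplicative tensor_square G -> G} :=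
  sval (cid (tensor_lift (@commMgJ G) (@commgMJ G))).

Lemma tensor_commE g h : tensor_comm (tensor g h) = [~ g, h].
Proof. by rewrite /tensor_comm; case: cid. Qed.

Lemma tensor1g h : tensor 1 h = 1.
Proof.
apply: (mulgI (tensor 1 h)); rewrite mulg1.
by have := tensorMl 1 1 h; rewrite mul1g conj1g conjg1.
Qed.

Lemma tensorVJ g h : tensor g^-1 (h ^ g) = (tensor g h)^-1.
Proof.
have gg : g ^ g = g by rewrite /conjg mulKg.
have := tensorMl g^-1 g h; rewrite mulVg tensor1g conjVg gg.
by move/esym/(canRL (mulgK _)); rewrite mul1g.
Qed.

(** Expanding (g a) (x) (h b) on the left first, then on the right first,
    gives two products with the same outer factors; cancelling these leaves
    the claim with g and h conjugated by b a. *)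
Lemma tensorJ_tensor g h a b :
  tensor g h ^ tensor a b = tensor (g ^ [~ a, b]) (h ^ [~ a, b]).
Proof.
have key g' h' : tensor (g' ^ (b * a)) (h' ^ (b * a)) * tensor a b =
    tensor a b * tensor (g' ^ (a * b)) (h' ^ (a * b)).
  apply: (mulgI (tensor (g' ^ a) (b ^ a))).
  apply: (mulIg (tensor (a ^ b) (h' ^ b))).
  transitivity (tensor (g' * a) (h' * b)).
    rewrite (tensorMl g') conjMg (tensorMr _ (h' ^ a)) (tensorMr a).
    by rewrite -!conjgM -conjgC !mulgA.
  rewrite (tensorMr _ h') conjMg (tensorMl g' a) (tensorMl (g' ^ b)).
  by rewrite -!conjgM -conjgC !mulgA.
rewrite -{1}(conjgKV (b * a) g) -{1}(conjgKV (b * a) h).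
rewrite conjgE key mulKg -!conjgM.
by rewrite (_ : (b * a)^-1 * (a * b) = [~ a, b]) // /commg /conjg invgM !mulgA.
Qed.

Lemma tensorJ g h y :
  tensor g h ^ y = tensor (g ^ tensor_comm y) (h ^ tensor_comm y).
Proof.
elim/(@presented_ind (G * G)%type (@tensor_rel G)): y g h
  => [[a b]|a b IHa IHb|a IHa|] g h.
- by rewrite tensorJ_tensor tensor_commE.
- by rewrite gmulfM !conjgM IHa IHb.
- apply: (conjg_inj a); rewrite conjgKV IHa morph_groupV -!conjgM mulVg.
  by rewrite !conjg1.
- by rewrite morph_group1 !conjg1.
Qed.

(** This is the generator case of comm_tensor. Writing [g, k] as g^-1 * g^k
    and expanding, tensorJ_tensor turns the first factor into a conjugate of
    (g (x) h)^-1; what remains is the equality of the two expansions of g (x)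
    k h = g (x) h^(k^-1) k. *)
Lemma tensor_comm_gen_l g k h :
  tensor [~ g, k] h = (tensor g k)^-1 * tensor (g ^ h) (k ^ h).
Proof.
set c := [~ g, k]; have gkE : g ^ k = g * c by rewrite /c commgEl mulVKg.
have gcE : g ^ (g ^ k) = g ^ c by rewrite gkE conjgM {2}/conjg mulKg.
have hE : h ^ (g ^ k) = (h ^ c) ^ (g ^ c) by rewrite gkE (conjgC g c) conjgM.
rewrite {1}/c commgEl tensorMl conjVg hE gcE tensorVJ.
rewrite -tensorJ_tensor conjgE !invgM invgK -!mulgA; congr (_ * _).
apply: (mulgI (tensor g h)); rewrite mulVKg.
rewrite -(tensorMr g k h) conjgCV (tensorMr g (h ^ k^-1) k).
by rewrite conjgKV.
Qed.

(** The fundamental identity. It makes the kernel of the commutator map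
    central, and it computes the commutator of any two elements of the tensor
    square from their images in G alone. *)
Lemma comm_tensor x y :
  [~ x, y] = tensor (tensor_comm x) (tensor_comm y).
Proof.
elim/(@presented_ind (G * G)%type (@tensor_rel G)): x y
  => [[g k]|a b IHa IHb|a IHa|] y.
- by rewrite tensor_commE tensor_comm_gen_l commgEl tensorJ.
- rewrite commMgJ gmulfM tensorMl IHb; congr (_ * _).
  by rewrite -tensorJ -IHa conjRg.
- rewrite -(conjgKV a y); move: (y ^ a^-1) => z.
  rewrite morph_groupV morph_groupJ tensorVJ -IHa invgR /commg /conjg.
  by rewrite !invgM !invgK !mulgA mulgV mul1g mulgK.
- by rewrite morph_group1 tensor1g comm1g.
Qed.

Lemma tensor_diag x : tensor (tensor_comm x) (tensor_comm x) = 1.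
Proof. by rewrite -comm_tensor commgg. Qed.

Lemma tensor_comm_ker_central z y : tensor_comm z = 1 -> commute z y.
Proof. by move=> z1; apply/commgP; rewrite comm_tensor z1 tensor1g. Qed.

End CommutatorMap.

Arguments tensor_comm {G}.

(** * Tensor squares of perfect groups *)

Section Perfect.
Variable G : groupType.
Hypothesis perfG : forall g : G, exists x, tensor_comm x = g.
Implicit Types (g u v t : G).

(** When g is the image of x, the element g (x) g is [x, x] = 1, so there is
    nothing to divide out. *)
Lemma exterior_proj_bijective : bijective (exterior_proj G).
Proof.
have diag g : tensor g g = 1 by have [x <-] := perfG g; exact: tensor_diag.
exists repr => [x|y]; last exact: nquotient_reprK.
have /nquotientP nc : exterior_proj G (repr (exterior_proj G x)) =
    exterior_proj G x by exact: nquotient_reprK.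
apply: (mulgI (repr (exterior_proj G x))^-1); rewrite mulVg.
elim: nc => {x} [z [g _ <-]|//|y z _ <- _ <-|z _ <-|y z _ <-].
- by rewrite diag.
- by rewrite mulg1.
- by rewrite invg1.
- by rewrite conj1g.
Qed.

(** For commuting u and v the element u (x) v lies in the central kernel of
    the commutator map, and conjugation by t is conjugation by a preimage of
    t. Hence the tensor is bimultiplicative on pairs of commuting elements and
    invariant under simultaneous conjugation. *)
Lemma tensorJ_commute u v t :
  commute u v -> tensor (u ^ t) (v ^ t) = tensor u v.
Proof.
move=> uv; have [x <-] := perfG t; rewrite -tensorJ.
apply/conjg_fixP/commgP; apply: tensor_comm_ker_central.
by rewrite tensor_commE; apply/eqP/commgP.
Qed.

Lemma tensorMl_commute u u' v :
  commute u v -> tensor (u * u') v = tensor u v * tensor u' v.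
Proof. by move=> uv; rewrite tensorMl tensorJ_commute. Qed.

Lemma tensorMr_commute u v v' :
  commute u v -> tensor u (v * v') = tensor u v' * tensor u v.
Proof. by move=> uv; rewrite tensorMr tensorJ_commute. Qed.

End Perfect.

(** * Central extensions and cocycles *)

(** In a central extension the commutator of two elements depends only on
    their images in G, and it satisfies the tensor relations. This is the tool
    that shows that some tensors are not trivial. *)
Lemma central_extension_lift (G H : groupType) (p : {multiplicative H -> G})
    (s : G -> H) :
    cancel s p -> (forall z y, p z = 1 -> commute z y) ->
  exists F : {multiplicative tensor_square G -> H},
    forall g h, F (tensor g h) = [~ s g, s h].
Proof.
move=> sK pZ.
have commE x x' y y' : p x = p x' -> p y = p y' -> [~ x, y] = [~ x', y'].
  have commEl u u' w : p u = p u' -> [~ u, w] = [~ u', w].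
    move=> uu'; rewrite -(mulgVK u' u); set z := u * u'^-1.
    have /pZ zZ : p z = 1 by rewrite gmulfM morph_groupV uu' mulgV.
    rewrite commMgJ; have /commgP/eqP -> : commute (z ^ u') (w ^ u').
      by rewrite (_ : z ^ u' = z) ?zZ //; apply/conjg_fixP/commgP.
    by rewrite mul1g.
  move=> xx' yy'; rewrite (commEl _ _ _ xx') -invgR (commEl _ _ _ yy').
  exact: invgR.
apply: tensor_lift => [g g1 h|g h h1].
  rewrite (commE (s (g * g1)) (s g * s g1) (s h) (s h)) ?gmulfM ?sK //.
  by rewrite commMgJ; congr (_ * _); apply: commE; rewrite morph_groupJ !sK.
rewrite (commE (s g) (s g) (s (h * h1)) (s h * s h1)) ?gmulfM ?sK //.
by rewrite commgMJ; congr (_ * _); apply: commE; rewrite morph_groupJ !sK.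
Qed.

Section CocycleExtension.
Variables (G : groupType) (C : zmodType).
Implicit Types (x y z : G).

(** A normalised 2-cocycle of G with values in C, for the trivial action. *)
Record cocycle := Cocycle {
  cocycle_val :> G -> G -> C;
  cocycle1g : forall x, cocycle_val 1 x = 0%R;
  cocycleg1 : forall x, cocycle_val x 1 = 0%R;
  cocycleP : forall x y z, (cocycle_val x y + cocycle_val (x * y)%g z =
    cocycle_val y z + cocycle_val x (y * z)%g)%R }.

Definition cocycle_ext of cocycle := (G * C)%type.

HB.instance Definition _ w := Choice.on (cocycle_ext w).

Variable w : cocycle.
Implicit Types a b : cocycle_ext w.

Definition cext_mul a b : cocycle_ext w :=
  (a.1 * b.1, (a.2 + b.2 + w a.1 b.1)%R).
Definition cext_inv a : cocycle_ext w := (a.1^-1, (- a.2 - w a.1^-1%g a.1)%R).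
Definition cext_one : cocycle_ext w := (1, 0%R).

Lemma cext_mulA : associative cext_mul.
Proof.
move=> a b c; congr pair => /=; first exact: mulgA.
rewrite -!addrA; congr (_ + (_ + _))%R.
by rewrite -cocycleP addrCA.
Qed.

Lemma cext_mul1 : left_id cext_one cext_mul.
Proof. by case=> x c; rewrite /cext_mul /= mul1g cocycle1g addr0 add0r. Qed.

Lemma cext_mulr1 : right_id cext_one cext_mul.
Proof. by case=> x c; rewrite /cext_mul /= mulg1 cocycleg1 !addr0. Qed.

Lemma cocycle_invC x : w x x^-1 = w x^-1 x.
Proof.
have := cocycleP w x x^-1 x.
by rewrite mulgV mulVg cocycle1g cocycleg1 !addr0.
Qed.

Lemma cext_mulV : left_inverse cext_one cext_inv cext_mul.
Proof.
case=> x c; rewrite /cext_mul /= mulVg; congr pair.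
by rewrite addrAC subrK addNr.
Qed.

Lemma cext_mulVr : right_inverse cext_one cext_inv cext_mul.
Proof.
case=> x c; rewrite /cext_mul /= mulgV; congr pair.
by rewrite cocycle_invC addrA subrK subrr.
Qed.

End CocycleExtension.

HB.instance Definition _ (G : groupType) (C : zmodType) (w : cocycle G C) :=
  isGroup.Build (cocycle_ext w) (@cext_mulA G C w) (@cext_mul1 G C w)
    (@cext_mulr1 G C w) (@cext_mulV G C w) (@cext_mulVr G C w).

Section CocycleProjection.
Variables (G : groupType) (C : zmodType) (w : cocycle G C).

Definition cext_proj (a : cocycle_ext w) : G := a.1.

Lemma cext_projM : {morph cext_proj : a b / a * b}.
Proof. by []. Qed.

HB.instance Definition _ :=
  isMultiplicative.Build (cocycle_ext w) G cext_proj cext_projM.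

(** In the central extension defined by the cocycle, the lifts (g, 0)
    and (h, 0) of commuting elements commute only when the cocycle is
    symmetric on them. *)
Lemma cocycle_tensor_neq1 (g h : G) :
  commute g h -> w g h <> w h g -> tensor g h <> 1.
Proof.
move=> gh wgh gh1.
have [||F Fgh] := @central_extension_lift G (cocycle_ext w) cext_proj
  (fun x => (x, 0%R)); first by [].
  move=> [x c] [y d] /= /[dup] + ->; rewrite /cext_proj /= => _.
  by congr pair; rewrite /= ?mul1g ?mulg1 // cocycle1g cocycleg1 (addrC c).
have : [~ (g, 0%R) : cocycle_ext w, (h, 0%R) : cocycle_ext w] = 1.
  by rewrite -Fgh gh1 morph_group1.
by move=> /eqP/commgP/(congr1 snd); rewrite /= !add0r.
Qed.

End CocycleProjection.

(** * Linear groups *)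

(** Linear groups satisfy the descending chain condition on centralisers. In
    the situation below the matrices of the a_i would be linearly independent,
    because in a dependency whose least index is i, commutation with b_(i+1)
    kills every term except the one of index i. The matrix space has finite
    dimension. *)
Lemma staircase_not_linear (T : groupType) (a b : nat -> T) :
    (forall i j, (j <= i)%N -> commute (a i) (b j)) ->
    (forall i, ~ commute (a i) (b i.+1)) ->
  ~ linear_group T.
Proof.
move=> ab_comm ab_ncomm [n [P [H [_ _ [f f_bij]]]]].
have f_inj : injective f.
  by move=> x y fxy; apply: (set_bij_inj f_bij); rewrite ?inE.
pose A i : 'M[P]_n := val (f (a i)); pose B i : 'M[P]_n := val (f (b i)).
have ABC i j : commute (a i) (b j) <-> (A i *m B j = B j *m A i)%R.
  rewrite /commute; split=> [abE|ABE]; last first.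
    by apply: f_inj; rewrite !gmulfM; apply: val_inj.
  by rewrite /A /B; have := congr1 (fun g => val (f g)) abE; rewrite !gmulfM.
pose M := (\matrix_(i < (n * n).+1) mxvec (A i))%R.
have /rowV0Pn[u /sub_kermxP uM nz_u] : kermx M != 0%R.
  by rewrite kermx_eq0 /row_free neq_ltn ltnS rank_leq_col.
have [k0 uk0] : exists k, u ord0 k != 0%R by apply/rV0Pn.
have [k uk min_k] :=
  @arg_minnP _ k0 (fun k => u ord0 k != 0%R) (fun i => val i) uk0.
have sumA : (\sum_i u ord0 i *: A i = 0)%R.
  apply: (can_inj mxvecK); rewrite linear0 -[RHS]uM mulmx_sum_row linear_sum.
  by apply: eq_bigr => i _; rewrite rowK linearZ.
apply: (ab_ncomm k); apply/ABC/(scalerI uk).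
have := congr1 (fun C => C *m B k.+1 - B k.+1 *m C)%R sumA.
rewrite mul0mx mulmx0 subrr mulmx_suml mulmx_sumr -sumrB (bigD1 k) //=.
rewrite big1 ?addr0 => [|i neq_ik].
  by rewrite -scalemxAl -scalemxAr => /eqP; rewrite subr_eq0 => /eqP.
have [/eqP-> | ui] := boolP (u ord0 i == 0%R).
  by rewrite scale0r mul0mx mulmx0 subrr.
rewrite -scalemxAl -scalemxAr; apply/eqP; rewrite subr_eq0; apply/eqP.
congr (_ *: _)%R; apply/ABC/ab_comm.
by rewrite ltn_neqAle eq_sym (inj_eq val_inj) neq_ik min_k.
Qed.

Lemma injective_linear_group (G : groupType) n (P : fieldType)
    (f : {multiplicative G -> GL n P}) :
  (0 < n)%N -> injective f -> linear_group G.
Proof.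
move=> n_gt0 f_inj; exists n, P, (range f); split => //; last first.
  by exists f; split=> // x y _ _ /f_inj.
split=> [|x y]; first by rewrite inE; exists 1 => //; apply: morph_group1.
rewrite !inE => -[g _ <-] [h _ <-].
by exists (g * h^-1) => //; rewrite gmulfM morph_groupV.
Qed.

(** * Generated subgroups *)

Section Generated.
Variables (U : groupType) (S : set U).
Implicit Types x y : U.

Inductive generated : U -> Prop :=
| Generator x : S x -> generated x
| Generated1 : generated 1
| GeneratedM x y : generated x -> generated y -> generated (x * y)
| GeneratedV x : generated x -> generated x^-1.

Definition generatedb : pred U := fun x => `[< generated x >].

Lemma generated_closed : group_closed generatedb.
Proof.
split=> [|x y /asboolP Sx /asboolP Sy]; apply/asboolP; first exact: Generated1.
exact/GeneratedM/GeneratedV.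
Qed.

Definition generated_group := {x : U | generatedb x}.

HB.instance Definition _ := SubChoice.on generated_group.
HB.instance Definition _ := SubChoice_isSubGroup.Build U generatedb
  generated_group generated_closed.

Definition generator x (Sx : S x) : generated_group :=
  Sub x (asboolT (Generator Sx)).

Lemma val_genM (a b : generated_group) : val (a * b) = val a * val b.
Proof. exact: gmulfM. Qed.

Lemma val_genJ (a b : generated_group) : val (a ^ b) = val a ^ val b.
Proof. exact: morph_groupJ. Qed.

Lemma val_genR (a b : generated_group) : val [~ a, b] = [~ val a, val b].
Proof. exact: morph_groupR. Qed.

(** The default value 1, off the generated subgroup, saves carrying membership
    proofs inside terms; the lemmas supply the membership as a hypothesis. *)
Definition gen x : generated_group := insubd (1 : generated_group) x.

Lemma val_gen x : S x -> val (gen x) = x.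
Proof.
by move=> Sx; rewrite val_insubd /generatedb (asboolT (Generator Sx)).
Qed.

Lemma generated_group_ind (A : generated_group -> Prop) :
    (forall x (Sx : S x), A (generator Sx)) -> A 1 ->
    (forall a b, A a -> A b -> A (a * b)) -> (forall a, A a -> A a^-1) ->
  forall a, A a.
Proof.
move=> AS A1 AM AV a; have /asboolP Sa := valP a.
suff : forall b : generated_group, val b = val a -> A b by apply.
elim: {a} (val a) / Sa => [x Sx|| x y Sx IHx Sy IHy |x Sx IHx] b bE.
- by rewrite (_ : b = generator Sx) //; apply: val_inj.
- by rewrite (_ : b = 1) //; apply: val_inj.
- pose c : generated_group := Sub x (asboolT Sx).
  pose d : generated_group := Sub y (asboolT Sy).
  rewrite (_ : b = c * d); last by apply: val_inj; rewrite bE.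
  by apply: AM; [apply: IHx | apply: IHy].
- pose c : generated_group := Sub x (asboolT Sx).
  rewrite (_ : b = c^-1); last by apply: val_inj; rewrite bE.
  by apply/AV/IHx.
Qed.

End Generated.

(** * Elementary matrices and frames *)

Section Elementary.
Variables (F : fieldType) (n : nat).
Implicit Types (i j k : 'I_n) (d : F).
Local Open Scope ring_scope.

Lemma elem_mx_mul i j d d' : i != j ->
  (1%:M + d *: delta_mx i j) *m (1%:M + d' *: delta_mx i j) =
  1%:M + (d + d') *: delta_mx i j :> 'M[F]_n.
Proof.
move=> neq_ij; rewrite mulmxDl !mulmxDr mul1mx !mulmx1 mul1mx -scalemxAl.
rewrite -scalemxAr mul_delta_mx_0 1?eq_sym // !scaler0 addr0.
by rewrite scalerDl -addrA (addrC (d' *: _)).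
Qed.

Lemma elem_mx_unit i j d : i != j ->
  (1%:M + d *: delta_mx i j : 'M[F]_n) \in unitmx.
Proof.
move=> neq_ij; apply: (proj1 (@mulmx1_unit _ _ _
  (1%:M + (- d) *: delta_mx i j) _)).
by rewrite elem_mx_mul // subrr scale0r addr0.
Qed.

Definition elem i j d : GL n F :=
  insubd (1%g : GL n F) (1%:M + d *: delta_mx i j).

Lemma elemE i j d : i != j -> val (elem i j d) = 1%:M + d *: delta_mx i j.
Proof. by move=> neq_ij; rewrite val_insubd elem_mx_unit. Qed.

Lemma elemV i j d : i != j -> (elem i j d)^-1%g = elem i j (- d).
Proof.
move=> neq_ij; apply: mulg1_eq; apply: val_inj => /=.
by rewrite !elemE // elem_mx_mul // subrr scale0r addr0.
Qed.

Lemma elem_comm i j k d d' : i != j -> i != k -> k != j ->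
  [~ elem i k d, elem k j d']%g = elem i j (d * d').
Proof.
move=> neq_ij neq_ik neq_kj.
apply: (mulgI (elem k j d' * elem i k d)%g); rewrite -commgC.
apply: val_inj; rewrite /= !elemE //.
rewrite !(mulmxDl, mulmxDr, mul1mx, mulmx1) -!scalemxAl -!scalemxAr.
rewrite !mul_delta_mx_cond eqxx !(eq_sym _ i) (negbTE neq_ij) (negbTE neq_ik).
rewrite !mulr0n !scaler0 mul0mx !scaler0 !addr0 scalerA !addrA.
by congr (_ + _); rewrite addrAC.
Qed.

End Elementary.

Section Frame.
Variables (F : fieldType) (n : nat).
Local Open Scope ring_scope.
Implicit Types (X Y : GL n F) (v : 'cV[F]_n) (w : 'rV[F]_n).

Lemma aff_unit X v : block_mx (val X) v 0 1%:M \in unitmx.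
Proof. by rewrite unitmxE det_ublock det1 mulr1 -unitmxE (valP X). Qed.

Lemma coaff_unit X w : block_mx (val X) 0 w 1%:M \in unitmx.
Proof. by rewrite unitmxE det_lblock det1 mulr1 -unitmxE (valP X). Qed.

Definition aff X v : GL (n + 1) F :=
  exist _ (block_mx (val X) v 0 1%:M) (aff_unit X v).
Definition coaff X w : GL (n + 1) F :=
  exist _ (block_mx (val X) 0 w 1%:M) (coaff_unit X w).

(** The column v is moved by the linear part X and the row w by the linear
    part Y. The two parts lie in different factors, so v and w do not
    interact; their product w v appears only in the cocycle below. *)
Definition frame X Y v w : (GL (n + 1) F * GL (n + 1) F)%type :=
  (aff X v, coaff Y w).

Lemma frameM X Y v w X' Y' v' w' :
  (frame X Y v w * frame X' Y' v' w')%g =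
  frame (X * X')%g (Y * Y')%g (val X *m v' + v) (w *m val Y' + w').
Proof.
by congr (_, _); apply: val_inj; rewrite /= mulmx_block;
  rewrite !(mul0mx, mulmx0, mul1mx, mulmx1) !(addr0, add0r).
Qed.

Lemma frame1 : frame 1%g 1%g 0 0 = 1%g.
Proof. by congr (_, _); apply: val_inj; rewrite /= -scalar_mx_block. Qed.

Lemma frameV X Y v w : (frame X Y v w)^-1%g =
  frame X^-1%g Y^-1%g (- (val X^-1%g *m v)) (- (w *m val Y^-1%g)).
Proof.
apply: mulg1_eq; rewrite frameM !mulgV -frame1; congr frame.
  by rewrite mulmxN mulmxA mulmxV ?(valP X) // mul1mx addNr.
by rewrite subrr.
Qed.

Lemma frame_conjE X Y v w :
  (frame 1%g 1%g v w ^ frame X Y 0 0)%g =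
  frame 1%g 1%g (val X^-1%g *m v) (w *m val Y).
Proof.
rewrite /conjg !frameV !frameM !mul1g !mulVg.
by rewrite !(mulmx0, mul0mx, mulmx1, mul1mx, add0r, addr0, oppr0).
Qed.

Lemma frame_commE X Y v w :
  [~ frame 1%g 1%g v w, frame X Y 0 0]%g =
  frame 1%g 1%g (val X^-1%g *m v - v) (w *m val Y - w).
Proof.
rewrite commgEl frame_conjE frameV frameM invg1 mul1g.
by rewrite mulmx1 mul1mx mul1mx mulmx1 (addrC (- w)).
Qed.

End Frame.

(** * Integral frames and their cocycle *)

Section IntegralFrames.
Variables (F : fieldType) (P : subringClosed F) (Q : zmodClosed F) (n : nat).
Hypothesis PQ : forall p q, p \in P -> q \in Q -> (p * q)%R \in Q.
Local Open Scope ring_scope.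
Implicit Types (X Y : GL n F) (v : 'cV[F]_n) (w : 'rV[F]_n).

Lemma mxOver_absorbl m p q (A : 'M_(m, p)) (B : 'M_(p, q)) :
  A \is a mxOver P -> B \is a mxOver Q -> A *m B \is a mxOver Q.
Proof.
move=> /mxOverP PA /mxOverP QB; apply/mxOverP => i j; rewrite mxE.
by apply: rpred_sum => k _; apply: PQ.
Qed.

Lemma mxOver_absorbr m p q (A : 'M_(m, p)) (B : 'M_(p, q)) :
  A \is a mxOver Q -> B \is a mxOver P -> A *m B \is a mxOver Q.
Proof.
move=> /mxOverP QA /mxOverP PB; apply/mxOverP => i j; rewrite mxE.
by apply: rpred_sum => k _; rewrite mulrC; apply: PQ.
Qed.

Definition integralGL X :=
  (val X \is a mxOver P) && (val X^-1%g \is a mxOver P).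

Lemma integralGL1 : integralGL 1%g.
Proof. by rewrite /integralGL invg1 /= mxOver_scalar ?rpred0 ?rpred1. Qed.

Lemma integralGLM X Y : integralGL X -> integralGL Y -> integralGL (X * Y)%g.
Proof.
move=> /andP[PX PX'] /andP[PY PY']; rewrite /integralGL invgM.
by rewrite !mxOverM.
Qed.

Lemma integralGLV X : integralGL X -> integralGL X^-1%g.
Proof. by rewrite /integralGL invgK andbC. Qed.

Lemma integralGL_elem i j d : i != j -> d \in P -> integralGL (elem i j d).
Proof.
move=> ij; suff PE c : c \in P -> val (elem i j c : GL n F) \is a mxOver P.
  by move=> Pd; rewrite /integralGL elemV // !PE // rpredN.
move=> Pc; rewrite elemE // rpredD ?mxOver_scalar ?rpred0 ?rpred1 //.
by apply: mxOverZ => //; apply/mxOverP => k l; rewrite mxE rpred_nat.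
Qed.

(** The linear parts are invertible over the ring P, the other entries lie in
    P, and the two linear parts are congruent modulo Q. *)
Variant integral_frame : GL (n + 1) F * GL (n + 1) F -> Prop :=
  IntegralFrame X Y v w of integralGL X & integralGL Y
    & v \is a mxOver P & w \is a mxOver P & val X - val Y \is a mxOver Q :
  integral_frame (frame X Y v w).

Lemma integral_frame1 : integral_frame 1%g.
Proof.
rewrite -frame1; apply: IntegralFrame; rewrite ?integralGL1 ?mxOver0 ?rpred0 //.
by rewrite subrr mxOver0 ?rpred0.
Qed.

Lemma integral_frameM g h :
  integral_frame g -> integral_frame h -> integral_frame (g * h)%g.
Proof.
case=> X Y v w /[dup] iX /andP[PX _] /[dup] iY /andP[PY _] Pv Pw QXY.
case=> X' Y' v' w' /[dup] iX' /andP[PX' _] /[dup] iY' /andP[PY' _] Pv' Pw' QXY'.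
rewrite frameM; apply: IntegralFrame; try exact: integralGLM.
- by rewrite rpredD ?mxOverM.
- by rewrite rpredD ?mxOverM.
have -> : val (X * X')%g - val (Y * Y')%g =
    (val X - val Y) *m val X' + val Y *m (val X' - val Y').
  by rewrite mulmxBl mulmxBr addrA subrK.
by apply: rpredD; [apply: mxOver_absorbr | apply: mxOver_absorbl].
Qed.

Lemma integral_frameV g : integral_frame g -> integral_frame g^-1%g.
Proof.
case=> X Y v w /[dup] iX /andP[_ PX] /[dup] iY /andP[_ PY] Pv Pw QXY.
rewrite frameV; apply: IntegralFrame; try exact: integralGLV.
- by rewrite rpredN mxOverM.
- by rewrite rpredN mxOverM.
suff -> : val X^-1%g - val Y^-1%g =
    val X^-1%g *m (- (val X - val Y)) *m val Y^-1%g.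
  by apply: mxOver_absorbr PY; apply: mxOver_absorbl; rewrite // rpredN.
rewrite opprB mulmxBr mulmxBl -mulmxA mulmxV ?(valP Y) // mulmx1.
by rewrite mulVmx ?(valP X) // mul1mx.
Qed.

(** The product of the row part of g and the column part of h, modulo Q: in
    block matrices of size 1 + n + 1 with diagonal (1, X, 1), where X is only
    known modulo Q, this is the corner entry that the multiplication adds. *)
Definition frame_pairing (g h : GL (n + 1) F * GL (n + 1) F) :
    {ideal_quot Q} :=
  \pi_({ideal_quot Q}) ((dlsubmx (val g.2) *m ursubmx (val h.1)) 0 0).

Lemma frame_pairingE X Y v w X' Y' v' w' :
  frame_pairing (frame X Y v w) (frame X' Y' v' w') =
  \pi_({ideal_quot Q}) ((w *m v') 0 0).
Proof. by rewrite /frame_pairing /= block_mxKdl block_mxKur. Qed.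

Lemma frame_pairing1g g : frame_pairing 1%g g = 0.
Proof.
rewrite -frame1 /frame_pairing /= block_mxKdl mul0mx mxE.
exact: raddf0.
Qed.

Lemma frame_pairingg1 g : frame_pairing g 1%g = 0.
Proof.
rewrite -frame1 /frame_pairing /= block_mxKur mulmx0 mxE.
exact: raddf0.
Qed.

(** Up to sign, the defect of the cocycle identity is w (X' - Y') v'', where
    X' and Y' are the linear parts of the middle frame; it vanishes because
    they are congruent modulo Q. *)
Lemma frame_pairing_cocycle g h k :
    integral_frame g -> integral_frame h -> integral_frame k ->
  frame_pairing g h + frame_pairing (g * h)%g k =
  frame_pairing h k + frame_pairing g (h * k)%g.
Proof.
case=> X Y v w _ _ _ Pw _ [X' Y' v' w' _ _ _ _ QXY'].
case=> X'' Y'' v'' w'' _ _ Pv'' _ _.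
rewrite !frameM !frame_pairingE -!raddfD; apply/eqP; rewrite -Quotient.idealrBE.
suff -> : (w *m v') 0 0 + ((w *m val Y' + w') *m v'') 0 0 -
    ((w' *m v'') 0 0 + (w *m (val X' *m v'' + v')) 0 0) =
    - ((w *m (val X' - val Y')) *m v'') 0 0.
  rewrite rpredN.
  exact: (mxOverP (mxOver_absorbr (mxOver_absorbl Pw QXY') Pv'')).
have entryD (A B : 'M[F]_1) : (A + B) 0 0 = A 0 0 + B 0 0 by rewrite mxE.
have entryN (A : 'M[F]_1) : (- A) 0 0 = - A 0 0 by rewrite mxE.
rewrite -!(entryD, entryN); congr (fun_of_matrix _ 0 0).
rewrite mulmxBr mulmxBl mulmxDl mulmxDr !mulmxA opprB !opprD.
by rewrite !addrA addrK -(addrA (w *m v')) addrC addKr.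
Qed.
End IntegralFrames.
(** * The frame group *)

Section FrameGroup.
Variables (F : fieldType) (P : subringClosed F) (Q : zmodClosed F).
Hypothesis PQ : forall p q, p \in P -> q \in Q -> (p * q)%R \in Q.
Local Open Scope ring_scope.
Implicit Types (X Y : GL 3 F) (v : 'cV[F]_3) (w : 'rV[F]_3) (i j : 'I_3).

(** The two linear parts of an elementary generator may be different elements
    of P, as long as they are congruent modulo Q. This freedom is what makes
    tensors with product in Q vanish. *)
Variant frame_gen : GL (3 + 1) F * GL (3 + 1) F -> Prop :=
| FrameElem i j d1 d2 of i != j & d1 \in P & d2 \in P & d1 - d2 \in Q :
    frame_gen (frame (elem i j d1) (elem i j d2) 0 0)
| FrameCol v of v \is a mxOver P : frame_gen (frame 1%g 1%g v 0)
| FrameRow w of w \is a mxOver P : frame_gen (frame 1%g 1%g 0 w).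

Definition frame_group := generated_group frame_gen.
HB.instance Definition _ := Group.on frame_group.
HB.instance Definition _ := SubChoice.on frame_group.

Lemma frame_group_integral (g : frame_group) : integral_frame P Q (val g).
Proof.
elim/(@generated_group_ind _ frame_gen): g => [_ []||g h|g].
- move=> i j d1 d2 ij Pd1 Pd2 Qd; apply: IntegralFrame;
    rewrite ?integralGL_elem ?mxOver0 ?rpred0 //.
  rewrite !elemE // opprD addrACA subrr add0r -scalerBl.
  by apply/mxOverP => k l; rewrite !mxE mulrC; apply: PQ; rewrite ?rpred_nat.
- move=> v Pv; apply: IntegralFrame; rewrite ?integralGL1 ?mxOver0 ?rpred0 //.
  by rewrite subrr mxOver0 ?rpred0.
- move=> w Pw; apply: IntegralFrame; rewrite ?integralGL1 ?mxOver0 ?rpred0 //.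
  by rewrite subrr mxOver0 ?rpred0.
- exact: integral_frame1.
- exact: integral_frameM.
- exact: integral_frameV.
Qed.

Definition frame_cocycle : cocycle frame_group {ideal_quot Q} :=
  @Cocycle frame_group _ (fun g h => frame_pairing Q (val g) (val h))
    (fun g => frame_pairing1g Q (val g)) (fun g => frame_pairingg1 Q (val g))
    (fun g h k => frame_pairing_cocycle PQ (frame_group_integral g)
       (frame_group_integral h) (frame_group_integral k)).

Definition elem_gen i j d1 d2 : frame_group :=
  gen frame_gen (frame (elem i j d1) (elem i j d2) 0 0).
Definition col_gen v : frame_group := gen frame_gen (frame 1%g 1%g v 0).
Definition row_gen w : frame_group := gen frame_gen (frame 1%g 1%g 0 w).

Lemma val_elem_gen i j d1 d2 :
    i != j -> d1 \in P -> d2 \in P -> d1 - d2 \in Q ->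
  val (elem_gen i j d1 d2) = frame (elem i j d1) (elem i j d2) 0 0.
Proof. by move=> *; apply: val_gen; apply: FrameElem. Qed.

Lemma val_col_gen v : v \is a mxOver P -> val (col_gen v) = frame 1%g 1%g v 0.
Proof. by move=> Pv; apply: val_gen; apply: FrameCol. Qed.

Lemma val_row_gen w : w \is a mxOver P -> val (row_gen w) = frame 1%g 1%g 0 w.
Proof. by move=> Pw; apply: val_gen; apply: FrameRow. Qed.

Lemma col_genD v v' : v \is a mxOver P -> v' \is a mxOver P ->
  col_gen (v + v') = (col_gen v * col_gen v')%g.
Proof.
move=> Pv Pv'; apply: val_inj; rewrite val_genM !val_col_gen ?rpredD //.
by rewrite frameM !mulg1 mul0mx addr0 mul1mx addrC.
Qed.

Lemma row_genD w w' : w \is a mxOver P -> w' \is a mxOver P ->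
  row_gen (w + w') = (row_gen w * row_gen w')%g.
Proof.
move=> Pw Pw'; apply: val_inj; rewrite val_genM !val_row_gen ?rpredD //.
by rewrite frameM !mulg1 mulmx0 addr0 mulmx1.
Qed.

Lemma col_gen0 : col_gen 0 = 1%g.
Proof.
by apply: val_inj; rewrite val_col_gen ?mxOver0 ?rpred0 // frame1.
Qed.

Lemma col_gen_row_gen_commute v w : v \is a mxOver P -> w \is a mxOver P ->
  commute (col_gen v) (row_gen w).
Proof.
move=> Pv Pw; apply: val_inj; rewrite !val_genM !val_col_gen ?val_row_gen //.
by rewrite !frameM !mulg1 !(mul0mx, mulmx0, mul1mx, mulmx1, add0r, addr0).
Qed.

Lemma mulmx_elem_delta i j d m (k : 'I_m) a :
  (d *: delta_mx i j) *m (a *: delta_mx j k) =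
  (d * a) *: delta_mx i k :> 'M[F]_(3, m).
Proof. by rewrite -scalemxAl -scalemxAr mul_delta_mx scalerA. Qed.

Lemma mulmx_delta_elem i j d m (k : 'I_m) a :
  (a *: delta_mx k i) *m (d *: delta_mx i j) =
  (a * d) *: delta_mx k j :> 'M[F]_(m, 3).
Proof. by rewrite -scalemxAl -scalemxAr mul_delta_mx scalerA. Qed.

Lemma mxOver_delta m p (i : 'I_m) (j : 'I_p) a :
  a \in P -> a *: delta_mx i j \is a mxOver P.
Proof.
by move=> Pa; apply: mxOverZ => //; apply/mxOverP => k l; rewrite mxE rpred_nat.
Qed.

Lemma neq_exists i : exists j : 'I_3, i != j.
Proof. by case: i => [[|i] lt_i]; [exists ord_max | exists ord0]. Qed.

Lemma third_index i j : exists k : 'I_3, (i != k) && (k != j).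
Proof.
have : (0 < #|~: [set i; j]|)%N.
  by rewrite cardsCs finset.setCK card_ord subn_gt0 ltnS cards2; case: eqP.
case/card_gt0P => k; rewrite !inE negb_or => /andP[ki kj].
by exists k; rewrite eq_sym ki.
Qed.

(** The Steinberg relations: every elementary matrix is a commutator of two
    others, as there are three indices, and elementary matrices move each
    basis vector by another one. *)
Lemma frame_group_perfect (g : frame_group) : exists x, tensor_comm x = g.
Proof.
pose im (h : frame_group) := exists x, tensor_comm x = h.
have imM a b : im a -> im b -> im (a * b)%g.
  by move=> [x <-] [y <-]; exists (x * y)%g; rewrite gmulfM.
have imR a b : im [~ a, b]%g by exists (tensor a b); apply: tensor_commE.
have im1 : im 1%g by exists 1%g; apply: morph_group1.
have im_col i a : a \in P -> im (col_gen (a *: delta_mx i 0)).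
  move=> Pa; have [j ij] := neq_exists i.
  suff -> : col_gen (a *: delta_mx i 0) =
      [~ col_gen (a *: delta_mx j 0), elem_gen i j (-1) (-1)]%g by exact: imR.
  have P1 : -1 \in P by rewrite rpredN rpred1.
  apply: val_inj; rewrite val_genR val_elem_gen ?subrr ?rpred0 //.
  rewrite !val_col_gen ?mxOver_delta // frame_commE !(mul0mx, subr0).
  by rewrite elemV // elemE // opprK mulmxDl mul1mx addrC addKr
    mulmx_elem_delta mul1r.
have im_row i a : a \in P -> im (row_gen (a *: delta_mx 0 i)).
  move=> Pa; have [j ij] := neq_exists i.
  suff -> : row_gen (a *: delta_mx 0 i) =
      [~ row_gen (a *: delta_mx 0 j), elem_gen j i 1 1]%g by exact: imR.
  have P1 : 1 \in P by rewrite rpred1.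
  apply: val_inj; rewrite val_genR val_elem_gen ?subrr ?rpred0 // 1?eq_sym //.
  rewrite !val_row_gen ?mxOver_delta // frame_commE !(mulmx0, subr0).
  rewrite elemE 1?eq_sym //.
  by rewrite mulmxDr mulmx1 addrC addKr mulmx_delta_elem mulr1.
elim/(@generated_group_ind _ frame_gen): g
  => [x Sx||a b ima imb|a [x <-]]; last first.
- by exists x^-1%g; apply: morph_groupV.
- exact: imM.
- exact: im1.
have -> : generator Sx = gen frame_gen x by apply: val_inj; rewrite val_gen.
case: Sx => [i j d1 d2 ij Pd1 Pd2 Qd|v Pv|w Pw].
- have [k /andP[ik kj]] := third_index i j.
  suff -> : gen frame_gen (frame (elem i j d1) (elem i j d2) 0 0) =
    [~ elem_gen i k d1 d2, elem_gen k j 1 1]%g by exact: imR.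
  apply: val_inj; rewrite val_genR !val_elem_gen ?subrr ?rpred0 ?rpred1 //.
  rewrite -[d1 in LHS]mulr1 -[d2 in LHS]mulr1 -!(@elem_comm _ _ i j k) //.
  rewrite /commg /conjg !frameV !frameM.
  by rewrite !(mulmx0, mul0mx, add0r, addr0, oppr0).
- suff [] : v \is a mxOver P /\ im (col_gen v) by [].
  rewrite [v]matrix_sum_delta.
  apply: (big_ind (fun u : 'cV_3 => u \is a mxOver P /\ im (col_gen u))).
  + split; first by rewrite mxOver0 ?rpred0.
    by have := im_col 0 0 (rpred0 _); rewrite scale0r.
  + move=> u u' [Pu imu] [Pu' imu']; rewrite rpredD // col_genD //.
    by split=> //; apply: imM.
  + move=> i _; rewrite big_ord1.
    by have Pvi := mxOverP Pv i 0; split; [exact: mxOver_delta | exact: im_col].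
- suff [] : w \is a mxOver P /\ im (row_gen w) by [].
  rewrite [w]matrix_sum_delta big_ord1.
  apply: (big_ind (fun u : 'rV_3 => u \is a mxOver P /\ im (row_gen u))).
  + split; first by rewrite mxOver0 ?rpred0.
    by have := im_row 0 0 (rpred0 _); rewrite scale0r.
  + move=> u u' [Pu imu] [Pu' imu']; rewrite rpredD // row_genD //.
    by split=> //; apply: imM.
  + move=> i _.
    by have Pwi := mxOverP Pw 0 i; split; [exact: mxOver_delta | exact: im_row].
Qed.

Let perf := frame_group_perfect.

Definition delta_tensor i a b : tensor_square frame_group :=
  tensor (col_gen (a *: delta_mx i 0)) (row_gen (b *: delta_mx 0 i)).

(** With X and Y the two linear parts of an elementary generator, this is the
    invariance (X^-1 v) (x) (w Y) = v (x) w, where X^-1 = 1 - d1 E_ij and Y =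
    1 + d2 E_ij. *)
Lemma tensor_elem_invariant v w i j d1 d2 :
    v \is a mxOver P -> w \is a mxOver P ->
    i != j -> d1 \in P -> d2 \in P -> d1 - d2 \in Q ->
  tensor (col_gen (v - (d1 * v j 0) *: delta_mx i 0))
         (row_gen (w + (w 0 i * d2) *: delta_mx 0 j)) =
  tensor (col_gen v) (row_gen w).
Proof.
move=> Pv Pw ij Pd1 Pd2 Qd.
rewrite -(tensorJ_commute perf (elem_gen i j d1 d2)
  (col_gen_row_gen_commute Pv Pw)).
have Pv' : v - (d1 * v j 0) *: delta_mx i 0 \is a mxOver P.
  by rewrite rpredB // mxOver_delta // rpredM // (mxOverP Pv).
have Pw' : w + (w 0 i * d2) *: delta_mx 0 j \is a mxOver P.
  by rewrite rpredD // mxOver_delta // rpredM // (mxOverP Pw).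
have dcol : delta_mx i j *m v = v j 0 *: delta_mx i 0.
  apply/matrixP => k l; rewrite [l]ord1 !mxE (bigD1 j) //=.
  rewrite big1 => [|m /negbTE mj].
    by rewrite !mxE eqxx !andbT addr0 mulrC.
  by rewrite !mxE mj andbF mul0r.
have drow : w *m delta_mx i j = w 0 i *: delta_mx 0 j.
  apply/matrixP => k l; rewrite [k]ord1 !mxE (bigD1 i) //=.
  rewrite big1 => [|m /negbTE mi].
    by rewrite !mxE eqxx !andTb addr0.
  by rewrite !mxE mi mulr0.
congr tensor; apply: val_inj; rewrite val_genJ val_elem_gen //.
  rewrite !val_col_gen // frame_conjE mul0mx elemV // elemE //.
  by rewrite mulmxDl mul1mx -scalemxAl dcol scalerA mulNr scaleNr.
rewrite !val_row_gen // frame_conjE mulmx0 elemE //.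
by rewrite mulmxDr mulmx1 -scalemxAr drow scalerA mulrC.
Qed.

(** Take v = - a e_k, w = b e_k and d1 = d2 = 1 in tensor_elem_invariant: the
    conjugation adds a e_i to v and does not change w. *)
Lemma tensor_offdiag i k a b : i != k -> a \in P -> b \in P ->
  tensor (col_gen (a *: delta_mx i 0)) (row_gen (b *: delta_mx 0 k)) = 1%g.
Proof.
move=> ik Pa Pb; have P1 : 1 \in P by rewrite rpred1.
have PNa : - a \in P by rewrite rpredN.
have := @tensor_elem_invariant (- a *: delta_mx k 0) (b *: delta_mx 0 k) i k 1 1
  (mxOver_delta _ _ PNa) (mxOver_delta _ _ Pb) ik P1 P1.
rewrite subrr rpred0 !mxE !eqxx (negbTE ik) andbF mulr0 mul0r scale0r addr0.
rewrite mulr1 mul1r -scaleNr opprK => /(_ isT).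
rewrite addrC col_genD ?mxOver_delta ?rpredN //.
rewrite (tensorMl_commute perf); last first.
  by apply: col_gen_row_gen_commute; apply: mxOver_delta.
set N := tensor (col_gen (- a *: _)) _ => e.
by apply: (mulIg N); rewrite mul1g -[RHS]e.
Qed.

(** Take v = a e_j and w = b e_i in tensor_elem_invariant and expand. The
    tensors off the diagonal vanish, so the two diagonal terms cancel. *)
Lemma delta_tensor_shift i j a b d1 d2 :
    i != j -> a \in P -> b \in P -> d1 \in P -> d2 \in P -> d1 - d2 \in Q ->
  delta_tensor j a (d2 * b) = delta_tensor i (d1 * a) b.
Proof.
move=> ij Pa Pb Pd1 Pd2 Qd; have ji : j != i by rewrite eq_sym.
have := @tensor_elem_invariant (a *: delta_mx j 0) (b *: delta_mx 0 i) i j d1 d2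
  (mxOver_delta _ _ Pa) (mxOver_delta _ _ Pb) ij Pd1 Pd2 Qd.
rewrite !mxE !eqxx !mulr1.
have Pd1a : - (d1 * a) \in P by rewrite rpredN rpredM.
have Pbd2 : b * d2 \in P by rewrite rpredM.
rewrite -scaleNr col_genD ?row_genD ?mxOver_delta //.
rewrite (tensorMl_commute perf); last first.
  by apply: commuteM; apply: col_gen_row_gen_commute; apply: mxOver_delta.
rewrite !(tensorMr_commute perf);
  try by apply: col_gen_row_gen_commute; apply: mxOver_delta.
rewrite (tensor_offdiag ji) // (tensor_offdiag ij) // mulg1 mul1g.
set N := tensor (col_gen (- _ *: _)) _ => TN1.
rewrite /delta_tensor [d2 * b]mulrC.
apply: (mulIg N); rewrite {}TN1 {}/N -(tensorMl_commute perf); last first.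
  by apply: col_gen_row_gen_commute; apply: mxOver_delta; rewrite // rpredM.
rewrite -col_genD ?mxOver_delta ?rpredM // scaleNr subrr.
by rewrite col_gen0 tensor1g.
Qed.

(** Shifting with d1 = d2 = a moves the whole product to one side, as
    1 (x) a b. When a b is in Q, shifting with (d1, d2) = (0, a b) moves this back to
    0 (x) 1. *)
Lemma delta_tensor_eq1 i a b :
  a \in P -> b \in P -> a * b \in Q -> delta_tensor i a b = 1%g.
Proof.
move=> Pa Pb Qab; have [j ij] := neq_exists i.
have P0 : 0 \in P by rewrite rpred0.
have P1 : 1 \in P by rewrite rpred1.
have Pab : a * b \in P by rewrite rpredM.
have Q0 : a - a \in Q by rewrite subrr rpred0.
have Qab' : 0 - a * b \in Q by rewrite sub0r rpredN.
rewrite -[a in LHS]mulr1 -(delta_tensor_shift ij P1 Pb Pa Pa Q0).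
rewrite -[a * b]mulr1 (delta_tensor_shift ij P1 P1 P0 Pab Qab').
by rewrite /delta_tensor mul0r scale0r col_gen0 tensor1g.
Qed.

(** The pairing of the row and the column in one order is a b modulo Q, and in
    the other order it is 0. *)
Lemma delta_tensor_neq1 i a b :
  a \in P -> b \in P -> a * b \notin Q -> delta_tensor i a b <> 1%g.
Proof.
move=> Pa Pb Qab; apply: (@cocycle_tensor_neq1 _ _ frame_cocycle).
  by apply: col_gen_row_gen_commute; apply: mxOver_delta.
rewrite /= val_col_gen ?val_row_gen ?mxOver_delta // !frame_pairingE mul0mx.
rewrite -scalemxAl -scalemxAr mul_delta_mx scalerA !mxE !eqxx mulr1.
by move=> /esym/eqP; rewrite -Quotient.idealrBE subr0 mulrC (negbTE Qab).
Qed.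

Lemma frame_group_linear : linear_group frame_group.
Proof.
pose bd (g : frame_group) : 'M[F]_(3 + 1 + (3 + 1)) :=
  block_mx (val (val g).1) 0 0 (val (val g).2).
have bd_unit g : bd g \in unitmx.
  rewrite unitmxE det_ublock unitrM -!unitmxE.
  by rewrite (valP (val g).1) (valP (val g).2).
pose f g : GL (3 + 1 + (3 + 1)) F := exist _ (bd g) (bd_unit g).
have fM : {morph f : g h / (g * h)%g}.
  move=> g h; apply: val_inj; rewrite /= mulmx_block.
  by rewrite !(mul0mx, mulmx0) !(addr0, add0r).
pose F_f := isMultiplicative.Build _ _ f fM.
pose fm : {multiplicative frame_group -> GL (3 + 1 + (3 + 1)) F} :=
  HB.pack f F_f.
apply: (@injective_linear_group _ _ _ fm) => // g h /(congr1 val).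
by case/eq_block_mx => /val_inj eq1 _ _ /val_inj eq2; apply: val_inj;
  rewrite [LHS]surjective_pairing eq1 eq2 -surjective_pairing.
Qed.

(** The preimages of the columns c_k e_0 and of the rows d_l e_0 in the tensor
    square form a staircase, as their commutators are the tensors evaluated in
    delta_tensor_eq1 and delta_tensor_neq1. *)
Lemma frame_group_tensor_not_linear (c d : nat -> F) :
    (forall k, c k \in P) -> (forall k, d k \in P) ->
    (forall k l, (l <= k)%N -> c k * d l \in Q) ->
    (forall k, c k * d k.+1 \notin Q) ->
  ~ linear_group (tensor_square frame_group).
Proof.
move=> Pc Pd Qcd NQcd.
have [a aE] := choice (fun k => perf (col_gen (c k *: delta_mx 0 0))).
have [b bE] := choice (fun k => perf (row_gen (d k *: delta_mx 0 0))).
apply: (@staircase_not_linear _ a b) => [k l le_lk|k /commgP/eqP].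
  apply/commgP/eqP; rewrite comm_tensor aE bE.
  by apply: delta_tensor_eq1; auto.
by rewrite comm_tensor aE bE; apply: delta_tensor_neq1.
Qed.

End FrameGroup.

(** * Iterated square roots of 2 *)

Section TwoPowerRoots.
Local Open Scope ring_scope.

Definition root2 k : algC := iter k sqrtC 2.

Lemma root2X k l : root2 (k + l) ^+ (2 ^ l) = root2 k.
Proof.
elim: l => [|l IHl]; first by rewrite addn0.
by rewrite expnS exprM addnS [root2 _.+1 ^+ 2]sqrtCK.
Qed.

Lemma root2X0 k : root2 k ^+ (2 ^ k) = 2.
Proof. exact: (root2X 0). Qed.

Lemma root2_neq0 k : root2 k != 0.
Proof.
apply: contra_eq_neq (root2X0 k) => ->.
by rewrite expr0n expn_eq0 /= eq_sym pnatr_eq0.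
Qed.

Lemma root2_Aint k : root2 k \in Aint.
Proof.
apply: (@root_monic_Aint ('X^(2 ^ k) - 2%:P)).
- by rewrite /root !hornerE root2X0 subrr.
- by rewrite monicXnsubC ?expn_gt0.
- by rewrite polyOverXnsubC rpred_nat.
Qed.

Lemma root2_div k l : (l <= k)%N -> root2 l / root2 k \in Aint.
Proof.
move=> /subnKC <-; rewrite -{1}(root2X l (k - l)).
rewrite -(@prednK (2 ^ (k - l))) ?expn_gt0 // exprSr mulfK ?root2_neq0 //.
by rewrite rpredX // root2_Aint.
Qed.

(** The quotient is the inverse of a root of 2, and a power of it is 1/2,
    which is rational without being an integer. *)
Lemma root2_divS k : root2 k.+1 / root2 k \notin Aint.
Proof.
have -> : root2 k.+1 / root2 k = (root2 k.+1)^-1.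
  rewrite -(root2X k 1) addn1 expr2 invfM mulrA divff ?mul1r //.
  exact: root2_neq0.
apply/negP => /(rpredX (2 ^ k.+1)); rewrite exprVn root2X0 => /Cint_rat_Aint.
rewrite rpredV rpred_nat => /(_ isT) /norm_intr_ge1.
rewrite invr_eq0 pnatr_eq0 => /(_ isT).
by rewrite normfV normr_nat invf_ge1 ?ltr0n // (ler_nat _ 2 1).
Qed.

End TwoPowerRoots.

Lemma dvdA2E (x : algC) : (x \in dvdA 2) = (x / 2 \in Aint)%R.
Proof. by rewrite unfold_in pnatr_eq0. Qed.

Theorem proposition3p1 :
  exists G : groupType,
    [/\ linear_group G,
        bijective (exterior_proj G) &
        ~ linear_group (tensor_square G)].
Proof.
have AQ p q : p \in Aint -> q \in dvdA 2 -> (p * q)%R \in dvdA 2.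
  by rewrite !dvdA2E -mulrA; apply: rpredM.
exists (frame_group Aint (dvdA 2)); split.
- exact: frame_group_linear.
- exact/exterior_proj_bijective/frame_group_perfect.
have nz2 : (2 != 0 :> algC)%R by rewrite pnatr_eq0.
have prodE k l : (2 / root2 k * root2 l / 2 = root2 l / root2 k)%R.
  by rewrite mulrC !mulrA mulVf // mul1r mulrC.
apply: (frame_group_tensor_not_linear AQ (c := fun k => (2 / root2 k)%R)
  (d := root2)) => [k|k|k l le_lk|k].
- exact: (@root2_div k 0).
- exact: root2_Aint.
- by rewrite dvdA2E prodE root2_div.
- by rewrite dvdA2E prodE root2_divS.
Qed.
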